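(* Fix $1<p<\infty$ and let $q$ be defined by $1/p+1/q=1$. Let $G$ be a commutative group, $U\subset G$ a $d$-dimensional quasicube and $V\subset U$. Then \[ \beta_p(V)\ge c_p^d\,|V|,\qquad\text{where } c_p=\frac{p^{1/p}q^{1/q}}{2}\le 1. \]
   Context: All groups are commutative and written additively. For a finite $U\subset G$ and $1<p<\infty$, $\beta_p(U)=\inf_{A,B}\frac{|A+B+U|}{|A|^{1/p}|B|^{1-1/p}}$, the infimum over all nonempty finite $A,B\subset G$. Quasicubes are defined recursively: a $0$-dimensional quasicube is any singleton; a finite set $U\subset G$ is a $d$-dimensional quasicube ($d\ge1$) if there is a proper subgroup $G'$ of $G$ and two distinct cosets $G'+x$, $G'+y$ such that $U\subset (G'+x)\cup(G'+y)$, both $U\cap(G'+x)$ and $U\cap(G'+y)$ are $(d-1)$-dimensional quasicubes, and $x-y$ has infinite order in $G/G'$. *)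

(* Defs.v *)
From HB Require Import structures.
From mathcomp Require Import all_boot all_order all_algebra.
From mathcomp Require Import finmap.
From mathcomp Require Import boolp classical_sets reals exp.
Set Implicit Arguments.
Unset Strict Implicit.
Unset Printing Implicit Defensive.
Import Order.TTheory GRing.Theory Num.Theory.
Local Open Scope fset_scope.
Local Open Scope ring_scope.

(* A commutative group written additively is a zmodType (zmodTypes carry a
   choice structure, so finite subsets are {fset G}). *)

Definition sumset (G : zmodType) (A B : {fset G}) : {fset G} :=
  [fset (a + b)%R | a in A, b in B].

Definition beta_p (R : realType) (G : zmodType) (p : R) (U : {fset G}) : R :=
  inf [set r : R | exists (A B : {fset G}),
        [/\ A != fset0, B != fset0 &
            r = (#|` sumset (sumset A B) U|)%:R /
                (((#|` A|)%:R) `^ (p^-1) * ((#|` B|)%:R) `^ (1 - p^-1))]]%classic.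

Definition is_subgroup (G : zmodType) (H : G -> Prop) : Prop :=
  [/\ H 0, (forall x y, H x -> H y -> H (x + y)) & (forall x, H x -> H (- x))].

(* d-dimensional quasicubes, following the recursive definition.
   The coset H + x is {g | H (g - x)}; U \cap (H + x) is described by
   membership; "x - y has infinite order in G/H" means no positive multiple
   of x - y lies in H. *)
Inductive quasicube (G : zmodType) : nat -> {fset G} -> Prop :=
| quasicube0 (g : G) : quasicube 0 [fset g]
| quasicubeS (d : nat) (U Ux Uy : {fset G}) (H : G -> Prop) (x y : G) :
    is_subgroup H ->
    (exists g, ~ H g) ->
    ~ H (x - y) ->
    (forall u, u \in U -> H (u - x) \/ H (u - y)) ->
    (forall u, u \in Ux <-> (u \in U /\ H (u - x))) ->
    (forall u, u \in Uy <-> (u \in U /\ H (u - y))) ->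
    quasicube d Ux -> quasicube d Uy ->
    (forall n : nat, (0 < n)%N -> ~ H ((x - y) *+ n)) ->
    quasicube d.+1 U.

(* Main.v *)
(* Write u = 1/p, v = 1/q. The bound c^d |V| |A|^u |B|^v <= |A+B+V| is proved
   by induction on d. If U lies in two cosets of H differing by t, of infinite
   order modulo H, then A and B may be assumed to lie in single cosets of
   H + Zt, by pairing the coset parts of each with the largest part of the
   other. Slicing along the cosets of H gives sizes a_i, b_j (i, j in Z), and
   the induction hypothesis reduces the claim to the inequality
     sum_k S_k >= c (x + y) (sum a_i)^u (sum b_j)^v
   for S_k >= x a_i^u b_j^v if i + j = k and S_k >= y a_i^u b_j^v if
   i + j + 1 = k. For y = e x with e <= 1, refine Z to (1/N)Z with
   a_(n+s) = a_n e^(ps), b_(n+s) = b_n e^(qs), S_(n+s) = S_n e^s for s in [0,1):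
   both hypotheses become one, so that a discrete Prekopa-Leindler inequality
   applies. Weighted AM-GM at each s and
     2 sum_s e^(2s) >= (1 + e) sum_s e^s
   then give the claim as N goes to infinity. *)
Require Import Defs.
From HB Require Import structures.
From mathcomp Require Import all_boot all_order all_algebra.
From mathcomp Require Import finmap.
From mathcomp Require Import boolp classical_sets reals exp.
From mathcomp Require Import zify ring lra.
Set Implicit Arguments.
Unset Strict Implicit.
Unset Printing Implicit Defensive.
Import Order.TTheory GRing.Theory Num.Theory.
Local Open Scope fset_scope.
Local Open Scope ring_scope.

(** * Means and a discrete Prekopa-Leindler inequality *)

(** Young's inequality for the conjugate exponents [u^-1] and [v^-1], taken at $x^u$ and $y^v$. *)
Lemma powR_mean_le (R : realType) (u v x y : R) :
  0 < u -> 0 < v -> u + v = 1 -> 0 <= x -> 0 <= y ->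
  x `^ u * y `^ v <= u * x + v * y.
Proof.
move=> u0 v0 uv x0 y0.
have := @conjugate_powR R (x `^ u) (y `^ v) u^-1 v^-1 (powR_ge0 _ _)
  (powR_ge0 _ _).
rewrite !invr_gt0 !invrK => /(_ u0 v0 uv).
rewrite -!powRrM !mulfV ?gt_eqF// !powRr1//.
by rewrite [x * u]mulrC [y * v]mulrC.
Qed.

Lemma powR_wmean_id (R : realType) (u v x : R) :
  u + v = 1 -> 0 <= x -> x `^ u * x `^ v = x.
Proof.
move=> uv x0; rewrite -powRD ?uv ?powRr1//.
by rewrite oner_eq0.
Qed.

Lemma powR_ler (R : realType) (w x y : R) :
  0 < w -> 0 <= x -> x <= y -> x `^ w <= y `^ w.
Proof.
move=> w0 x0 xy; apply: ge0_ler_powR => //; first exact: ltW.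
by rewrite nnegrE; exact: le_trans xy.
Qed.

Lemma powR_mean_ge (R : realType) (u v w x y : R) :
  0 < u -> 0 < v -> u + v = 1 -> 0 <= w -> w <= x -> w <= y ->
  w <= x `^ u * y `^ v.
Proof.
move=> u0 v0 uv w0 wx wy; rewrite -{1}(powR_wmean_id uv w0).
by apply: ler_pM; rewrite ?powR_ge0//; apply: powR_ler.
Qed.

Lemma seq_extremum (T : eqType) (r : rel T) (s : seq T) :
  total r -> transitive r -> s != [::] ->
  exists2 m, m \in s & {in s, forall x, r m x}.
Proof.
move=> tot tr; have rr x : r x x by have := tot x x; rewrite orbb.
elim: s => // a [|b s] IH _.
  by exists a; rewrite ?mem_head// => x; rewrite inE => /eqP ->.
have [//|m ms mP] := IH.
case/orP: (tot a m) => [am|ma].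
  exists a; first by rewrite mem_head.
  by move=> x; rewrite in_cons => /orP[/eqP ->//|/mP]; apply: tr.
exists m; first by rewrite in_cons ms orbT.
by move=> x; rewrite in_cons => /orP[/eqP ->|/mP].
Qed.

(** Running through [X] with the minimum of [Y] fixed, then through [Y] with the maximum of [X]
    fixed, produces an increasing chain of sums. *)
Lemma nat_sumset_size (X Y Z : seq nat) :
  uniq X -> uniq Y -> X != [::] -> Y != [::] ->
  {in X & Y, forall x y, (x + y)%N \in Z} ->
  (size X + size Y <= (size Z).+1)%N.
Proof.
move=> uX uY X0 Y0 XYZ.
have [x1 x1X x1P] := @seq_extremum _ geq X (fun m n => leq_total n m)
  (fun _ _ _ h1 h2 => leq_trans h2 h1) X0.
have [y0 y0Y y0P] := @seq_extremum _ leq Y leq_total leq_trans Y0.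
(* The minimum of [Y] is removed from the second list because its sum with [x1] already occurs in
   the first. *)
pose W := [seq (x + y0)%N | x <- X] ++ [seq (x1 + y)%N | y <- rem y0 Y].
have sW : (size W).+1 = (size X + size Y)%N.
  rewrite size_cat !size_map size_rem//.
  by case: Y y0Y {uY Y0 XYZ y0P W} => //= *; lia.
rewrite -sW ltnS; apply: uniq_leq_size; last first.
  move=> z; rewrite mem_cat => /orP[] /mapP[w wP ->]; apply: XYZ => //.
  exact: mem_rem wP.
rewrite cat_uniq !map_inj_uniq ?rem_uniq ?uX//=; last 2 first.
- by move=> a b /=; lia.
- by move=> a b /=; lia.
rewrite andbT; apply/hasPn => z /mapP[y]; rewrite mem_rem_uniq// inE.
move=> /andP[/= yy0 yY ->]; apply/negP => /mapP[x xX].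
have := x1P _ xX; have := y0P _ yY; move: yy0; lia.
Qed.

(* Layer-cake induction: subtract the smallest value of f and g, at which
   nat_sumset_size accounts for the loss, and drop the points where it is
   attained. *)
Lemma discrete_prekopa_leindler (R : realType) (f g h : nat -> R) (M : R)
    (X Y Z : seq nat) (x0 y0 : nat) :
  uniq X -> uniq Y ->
  {in X & Y, forall x y, (x + y)%N \in Z} ->
  {in X & Y, forall x y, Num.min (f x) (g y) <= h (x + y)%N} ->
  {in X, forall x, 0 <= f x <= M} -> {in Y, forall y, 0 <= g y <= M} ->
  {in Z, forall z, 0 <= h z} ->
  x0 \in X -> y0 \in Y -> f x0 = M -> g y0 = M ->
  \sum_(x <- X) f x + \sum_(y <- Y) g y - M <= \sum_(z <- Z) h z.
Proof.
have [n] := ubnP (size X + size Y); elim: n f g h M X Y Z => // n IH.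
move=> f g h M X Y Z sn uX uY XYZ minP fP gP hP x0X y0Y fx0 gy0.
have [|m ms mP] := @seq_extremum _ <=%R (map f X ++ map g Y) le_total le_trans.
  by case: (X) x0X.
have mf : {in X, forall x, m <= f x}.
  by move=> x xX; apply: mP; rewrite mem_cat map_f.
have mg : {in Y, forall x, m <= g x}.
  by move=> x xX; apply: mP; rewrite mem_cat map_f ?orbT.
have m0 : 0 <= m.
  move: ms; rewrite mem_cat => /orP[/mapP[x xX ->]|/mapP[x xX ->]].
    by case/andP: (fP _ xX).
  by case/andP: (gP _ xX).
(* This superlevel set of [h] still contains every sum $x + y$, and discarding the rest of [Z] only
   lowers the sum of [h]. *)
pose Z' := [seq z <- Z | m <= h z].
have XYZ' : {in X & Y, forall x y, (x + y)%N \in Z'}.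
  move=> x y xX yY; rewrite mem_filter XYZ// andbT.
  by apply: le_trans (minP _ _ xX yY); rewrite le_min mf ?mg.
have sZ : (size X)%:R + (size Y)%:R - 1 <= (size Z')%:R :> R.
  rewrite lerBlDr -natrD natr1 ler_nat; apply: nat_sumset_size => //.
    by case: (X) x0X.
  by case: (Y) y0Y.
have sumB (F : nat -> R) (s : seq nat) :
    \sum_(i <- s) F i = \sum_(i <- s) (F i - m) + m * (size s)%:R.
  by rewrite sumrB big_const_seq count_predT iter_addr_0 mulr_natr subrK.
have sumZ : \sum_(z <- Z') h z <= \sum_(z <- Z) h z.
  rewrite big_filter [leRHS](bigID (fun z => m <= h z))/= lerDl.
  by rewrite big_seq_cond sumr_ge0// => z /andP[/hP].
apply: le_trans sumZ; rewrite (sumB f) (sumB g) (sumB h).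
pose X' := [seq x <- X | m < f x]; pose Y' := [seq y <- Y | m < g y].
have sumX' : \sum_(x <- X) (f x - m) = \sum_(x <- X') (f x - m).
  rewrite big_filter (bigID (fun x => m < f x))/= [X in _ + X]big1_seq ?addr0//.
  move=> x /andP[]; rewrite -leNgt => fm xX; apply/eqP.
  by rewrite subr_eq0 eq_le fm mf.
have sumY' : \sum_(x <- Y) (g x - m) = \sum_(x <- Y') (g x - m).
  rewrite big_filter (bigID (fun x => m < g x))/= [X in _ + X]big1_seq ?addr0//.
  move=> x /andP[]; rewrite -leNgt => fm xX; apply/eqP.
  by rewrite subr_eq0 eq_le fm mg.
(* Removing the layer of height [m] takes $m(|X| + |Y| - 1)$ from the left and $m|Z'|$ from the
   right, so [sZ] reduces the claim to the shifted functions, with maximum [M - m]. *)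
suff : \sum_(x <- X) (f x - m) + \sum_(x <- Y) (g x - m) - (M - m)
     <= \sum_(z <- Z') (h z - m).
  have := ler_wpM2l m0 sZ; rewrite mulrBr mulrDr mulr1; lra.
(* If [M <= m], the shifted sums over [X] and [Y] vanish. Otherwise [x0] and [y0] survive in [X']
   and [Y'], while a point attaining [m] is lost, so the induction applies. *)
have [Mm|mM] := leP M m.
  rewrite sumX' sumY' /X' /Y'.
  have -> : [seq x <- X | m < f x] = [::].
    apply/eqP; rewrite -(negbK (_ == _)) -has_filter; apply/hasPn => x xX.
    by rewrite -leNgt (le_trans _ Mm)//; case/andP: (fP _ xX).
  have -> : [seq x <- Y | m < g x] = [::].
    apply/eqP; rewrite -(negbK (_ == _)) -has_filter; apply/hasPn => x xX.
    by rewrite -leNgt (le_trans _ Mm)//; case/andP: (gP _ xX).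
  have := mf _ x0X; rewrite fx0 => mM.
  have -> : M = m by apply/eqP; rewrite eq_le Mm mM.
  rewrite !big_nil subrr subr0 addr0 big_seq sumr_ge0// => z.
  by rewrite mem_filter subr_ge0 => /andP[].
rewrite sumX' sumY'.
apply: (IH (fun x => f x - m) (fun x => g x - m) (fun z => h z - m)).
- have [sX sY] : (size X' <= size X)%N /\ (size Y' <= size Y)%N.
    by rewrite !size_filter !count_size.
  suff : (size X' < size X)%N \/ (size Y' < size Y)%N by lia.
  rewrite !ltn_neqAle !size_filter.
  rewrite !count_size !andbT -!all_count.
  move: ms; rewrite mem_cat => /orP[/mapP[x xX mE]|/mapP[x xX mE]].
    by left; apply/negP => /allP/(_ _ xX); rewrite -mE ltxx.
  by right; apply/negP => /allP/(_ _ xX); rewrite -mE ltxx.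
- exact: filter_uniq.
- exact: filter_uniq.
- move=> x y; rewrite !mem_filter => /andP[_ xX] /andP[_ yY].
  by have := XYZ' _ _ xX yY; rewrite mem_filter.
- move=> x y; rewrite !mem_filter => /andP[_ xX] /andP[_ yY].
  have := minP _ _ xX yY; rewrite !ge_min.
  by rewrite !lerD2r.
- move=> x; rewrite !mem_filter => /andP[_ xX].
  by rewrite subr_ge0 mf// lerD2r; case/andP: (fP _ xX).
- move=> x; rewrite !mem_filter => /andP[_ xX].
  by rewrite subr_ge0 mg// lerD2r; case/andP: (gP _ xX).
- by move=> z; rewrite mem_filter subr_ge0 => /andP[].
- by rewrite mem_filter fx0 mM.
- by rewrite mem_filter gy0 mM.
- by rewrite fx0.
- by rewrite gy0.
Qed.

(** * Refinement of the integers and the two-point inequality *)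

Lemma powRX (R : realType) (x w : R) (n : nat) :
  0 <= x -> (x ^+ n) `^ w = (x `^ w) ^+ n.
Proof.
move=> x0; elim: n => [|n IH]; first by rewrite !expr0 powR1.
by rewrite !exprS powRM ?exprn_ge0// IH.
Qed.

(** Multiplied by $t - 1$, both sides become $t^{2N} - 1$; the induction avoids dividing, so $t = 1$
    is included. *)
Lemma geometric_sum_double (R : comRingType) (t : R) (N : nat) :
  (1 + t ^+ N) * \sum_(s < N) t ^+ s = (1 + t) * \sum_(s < N) (t ^+ s) ^+ 2.
Proof.
elim: N => [|N IH]; first by rewrite !big_ord0 !mulr0.
rewrite !big_ord_recr/= [RHS]mulrDr -IH exprS.
have := subrX1 t N; set W := \sum_(i < N) t ^+ i; set y := t ^+ N => E.
have {E} -> : y = t * W - W + 1 by rewrite -(subrK 1 y) E; ring.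
ring.
Qed.

(** The index $x = iN + s$ with $s < N$ encodes the point $i + s/N$ of the refined integers. *)
Lemma sum_divn_modn (R : nmodType) (F : nat -> nat -> R) (m N : nat) :
  (0 < N)%N ->
  \sum_(x <- iota 0 (m * N)) F (x %/ N)%N (x %% N)%N =
  \sum_(i < m) \sum_(s < N) F i s.
Proof.
move=> N0; elim: m => [|m IH]; first by rewrite mul0n big_nil big_ord0.
rewrite mulSnr iotaD big_cat/= IH big_ord_recr/=; congr (_ + _).
rewrite add0n -[X in iota X _]addn0 iotaDl big_map.
rewrite -[in RHS](big_mkord xpredT (F m)) /index_iota subn0.
rewrite !big_seq; apply: eq_bigr => s; rewrite mem_iota add0n => /= sN.
by rewrite divnMDl// modnMDl divn_small// modn_small// addn0.
Qed.

(* Each unit interval is refined into N points carrying geometric weights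
   tuned so that the two hypotheses on S merge into a single one on nat; the
   additive loss in discrete_prekopa_leindler becomes O(1/N). *)
Lemma two_point_prekopa_leindler_approx (R : realType) (u v e : R)
    (a b S : nat -> R) (m n i0 j0 N : nat) :
  0 < u -> 0 < v -> u + v = 1 -> 0 < e <= 1 -> (0 < N)%N ->
  (forall i, 0 <= a i <= 1) -> (forall j, 0 <= b j <= 1) ->
  (forall k, 0 <= S k) ->
  (forall i j, a i `^ u * b j `^ v <= S (i + j)%N) ->
  (forall i j, e * (a i `^ u * b j `^ v) <= S (i + j).+1) ->
  (i0 < m)%N -> (j0 < n)%N -> a i0 = 1 -> b j0 = 1 ->
  (u^-1 `^ u * v^-1 `^ v) / 2 * (1 + e) *
    ((\sum_(i < m) a i) `^ u * (\sum_(j < n) b j) `^ v) - (N%:R * e)^-1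
  <= \sum_(k < m + n) S k.
Proof.
move=> u0 v0 uv /andP[e0 e1] N0 aP bP SP S0 S1 i0m j0n ai0 bj0.
(* With ratio [t] per step, the $N$ steps across a unit interval produce exactly the factor [e] of
   the second hypothesis on [S]. *)
pose t : R := e `^ (N%:R^-1).
have tN : t ^+ N = e.
  rewrite -powR_mulrn ?powR_ge0// -powRrM mulVf ?pnatr_eq0 -?lt0n//.
  by rewrite powRr1 ?ltW.
have t0 : 0 < t by exact: powR_gt0.
have pow1 w : 0 < w -> forall x : R, 0 < x <= 1 -> 0 < x `^ w <= 1.
  move=> w0 x /andP[x0 x1]; rewrite powR_gt0//=.
  rewrite -[leRHS](@powRr0 _ x) ger_powR// ?x0//.
  exact: ltW.
have t1 : 0 < t <= 1 by rewrite pow1 ?e0 ?invr_gt0 ?ltr0n.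
(* These ratios satisfy $T^u = T'^v = t$, so in the weighted geometric mean the weights of [f] and
   [g] multiply to a power of [t]. *)
pose T := t `^ u^-1; pose T' := t `^ v^-1.
have T1 : 0 < T <= 1 by rewrite pow1 ?invr_gt0.
have T'1 : 0 < T' <= 1 by rewrite pow1 ?invr_gt0.
have [T0 T'0] : 0 < T /\ 0 < T' by case/andP: T1; case/andP: T'1.
have expw w s : 0 < w -> ((t `^ w^-1) ^+ s) `^ w = t ^+ s.
  move=> w0; have Tw : (t `^ w^-1) `^ w = t.
    by rewrite -powRrM mulVf ?gt_eqF// powRr1 ?ltW.
  by rewrite powRX ?powR_ge0// Tw.
pose f x := a (x %/ N)%N * T ^+ (x %% N).
pose g x := b (x %/ N)%N * T' ^+ (x %% N).
pose h x := S (x %/ N)%N * t ^+ (x %% N).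
have prod01 (x y : R) : 0 <= x <= 1 -> 0 <= y <= 1 -> 0 <= x * y <= 1.
  by move=> /andP[x0 x1] /andP[y0 y1]; rewrite mulr_ge0//= mulr_ile1.
have exp01 (x : R) k : 0 < x <= 1 -> 0 <= x ^+ k <= 1.
  by move=> /andP[/ltW x0 x1]; rewrite exprn_ge0 ?exprn_ile1.
have fP x : 0 <= f x <= 1 by apply: prod01 => //; exact: exp01.
have gP x : 0 <= g x <= 1 by apply: prod01 => //; exact: exp01.
have hfg x y : f x `^ u * g y `^ v <= h (x + y)%N.
  have /andP[ax _] := aP (x %/ N)%N; have /andP[bY _] := bP (y %/ N)%N.
  rewrite /f /g !powRM ?exprn_ge0 ?powR_ge0// !expw//.
  rewrite mulrACA -exprD /h.
  have [sN rN] : (x %% N < N)%N /\ (y %% N < N)%N by rewrite !ltn_pmod.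
  have Exy : (x + y = (x %/ N + y %/ N) * N + (x %% N + y %% N))%N.
    by rewrite mulnDl addnACA -!divn_eq.
  have dm q r : (r < N)%N -> ((q * N + r) %/ N = q /\ (q * N + r) %% N = r)%N.
    by move=> rN'; rewrite divnMDl// modnMDl divn_small// modn_small// addn0.
  (* Without a carry the quotients add and [S0] applies. With a carry the quotient is one larger,
     and the surplus $t^N = e$ calls for [S1]. *)
  have [lt|ge] := ltnP (x %% N + y %% N) N.
    rewrite Exy; have [-> ->] := dm (x %/ N + y %/ N)%N _ lt.
    by rewrite ler_wpM2r// exprn_ge0 ?ltW.
  have [r Er rlt] : exists2 r, (x %% N + y %% N = N + r)%N & (r < N)%N.
    exists (x %% N + y %% N - N)%N; first by rewrite subnKC.
    by rewrite ltn_subLR// -addnS leq_add// ltnW.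
  rewrite Exy Er addnA -mulSnr; have [-> ->] := dm (x %/ N + y %/ N).+1 _ rlt.
  rewrite exprD tN mulrA; apply: ler_wpM2r; first by rewrite exprn_ge0 ?ltW.
  by rewrite mulrC.
have := @discrete_prekopa_leindler R f g h 1 (iota 0 (m * N)) (iota 0 (n * N))
  (iota 0 ((m + n) * N)) (i0 * N) (j0 * N) (iota_uniq _ _) (iota_uniq _ _).
rewrite /f /g /h.
rewrite (@sum_divn_modn _ (fun i s => a i * T ^+ s))//.
rewrite (@sum_divn_modn _ (fun i s => b i * T' ^+ s))//.
rewrite (@sum_divn_modn _ (fun i s => S i * t ^+ s))//.
have sumM (F : nat -> R) (x : R) k :
    \sum_(i < k) \sum_(s < N) F i * x ^+ s =
    \sum_(s < N) x ^+ s * (\sum_(i < k) F i).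
  rewrite exchange_big/=; apply: eq_bigr => s _.
  by rewrite mulr_sumr; apply: eq_bigr => i _; rewrite mulrC.
rewrite !sumM => PL.
set A := \sum_(i < m) a i in PL *; set B := \sum_(j < n) b j in PL *.
set W := \sum_(k < m + n) S k in PL *.
have A0 : 0 <= A by apply: sumr_ge0 => i _; case/andP: (aP i).
have B0 : 0 <= B by apply: sumr_ge0 => i _; case/andP: (bP i).
set k2 := _ `^ u * _ `^ v; set X := A `^ u * B `^ v.
have X0 : 0 <= X by rewrite mulr_ge0 ?powR_ge0.
have k20 : 0 <= k2 by rewrite mulr_ge0 ?powR_ge0.
(* AM-GM at $u^{-1}T^sA$ and $v^{-1}T'^sB$: the inverses cancel the weights and leave [k2], while
   $T^{su}T'^{sv} = t^{2s}$. *)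
have termwise s : k2 * X * (t ^+ s) ^+ 2 <= T ^+ s * A + T' ^+ s * B.
  have Ts0 : 0 <= T ^+ s by rewrite exprn_ge0 ?ltW.
  have T's0 : 0 <= T' ^+ s by rewrite exprn_ge0 ?ltW.
  have [ui0 vi0] : 0 <= u^-1 /\ 0 <= v^-1 by rewrite !invr_ge0 !ltW.
  have := @powR_mean_le R u v (u^-1 * (T ^+ s * A)) (v^-1 * (T' ^+ s * B))
    u0 v0 uv (mulr_ge0 ui0 (mulr_ge0 Ts0 A0)) (mulr_ge0 vi0 (mulr_ge0 T's0 B0)).
  rewrite !powRM ?mulr_ge0// !expw// mulVKf ?gt_eqF// mulVKf ?gt_eqF//.
  apply: le_trans; rewrite [leRHS](_ : _ = k2 * X * (t ^+ s) ^+ 2)//.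
  by rewrite /k2 /X; ring.
have {PL} PL : k2 * X * (\sum_(s < N) (t ^+ s) ^+ 2) - 1
     <= (\sum_(s < N) t ^+ s) * W.
  rewrite mulr_suml; apply: le_trans (PL _ _ _ _ _ _ _ _ _); first last.
  - by rewrite mulnK// modnMl expr0 bj0 mulr1.
  - by rewrite mulnK// modnMl expr0 ai0 mulr1.
  - by rewrite mem_iota/= add0n ltn_pmul2r.
  - by rewrite mem_iota/= add0n ltn_pmul2r.
  - by move=> z _; rewrite mulr_ge0// exprn_ge0// ltW.
  - by move=> y _; exact: gP.
  - by move=> x _; exact: fP.
  - move=> x y _ _; apply: le_trans (hfg x y).
    have /andP[fx _] := fP x; have /andP[gy _] := gP y.
    by apply: powR_mean_ge => //; rewrite ?le_min ?fx ?gy// ge_min lexx ?orbT.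
  - move=> x y; rewrite !mem_iota !add0n !leq0n /= mulnDl => xm yn.
    by rewrite -addSn leq_add// ltnW.
  - rewrite lerD2r -big_split/= mulr_sumr.
    by apply: ler_sum => s _; exact: termwise.
have E2 : (1 + e) / 2 * (\sum_(s < N) t ^+ s) <= \sum_(s < N) (t ^+ s) ^+ 2.
  have := geometric_sum_double t N; rewrite tN => E.
  have -> : (1 + e) / 2 * (\sum_(s < N) t ^+ s) =
    (1 + t) / 2 * \sum_(s < N) (t ^+ s) ^+ 2.
    by rewrite mulrAC E mulrAC.
  rewrite ler_piMl//; first by apply: sumr_ge0 => s _; exact: sqr_ge0.
  by case/andP: t1 => *; lra.
(* Every term is at least $t^N = e$; dividing by this sum turns the loss of 1 into at most
   $1/(Ne)$. *)
have sumt : N%:R * e <= \sum_(s < N) t ^+ s.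
  rewrite mulrC mulr_natr -[X in _ *+ X]card_ord -sumr_const.
  apply: ler_sum => s _; rewrite -tN.
  by case/andP: t1 => /ltW t0' t1'; apply: ler_wiXn2l => //; exact: ltnW.
set Q := \sum_(s < N) t ^+ s in PL E2 sumt *.
have Ne0 : 0 < N%:R * e by rewrite mulr_gt0 ?ltr0n.
have Q0 : 0 < Q by exact: lt_le_trans sumt.
have step : k2 * X * ((1 + e) / 2 * Q) - 1 <= Q * W.
  by apply: le_trans PL; rewrite lerD2r; apply: ler_wpM2l E2; exact: mulr_ge0.
have : k2 * X * ((1 + e) / 2) - Q^-1 <= W.
  rewrite -(ler_pM2l Q0); apply: le_trans step.
  rewrite mulrBr mulfV ?gt_eqF// lerD2r.
  by rewrite [leLHS](_ : _ = k2 * X * ((1 + e) / 2 * Q))//; ring.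
apply: le_trans; apply: lerB; last by rewrite lef_pV2.
by rewrite [leLHS](_ : _ = k2 * X * ((1 + e) / 2))//; ring.
Qed.

(** The Archimedean property takes the place of the limit $N \to \infty$. *)
Lemma le_of_le_inv_natmul (R : archiRealFieldType) (e x y : R) :
  0 < e -> (forall N : nat, (0 < N)%N -> x - (N%:R * e)^-1 <= y) -> x <= y.
Proof.
move=> e0 xy; rewrite leNgt; apply/negP => yx.
have d0 : 0 < x - y by rewrite subr_gt0.
have de0 : 0 < ((x - y) * e)^-1 by rewrite invr_gt0 mulr_gt0.
have bd := archi_boundP (ltW de0).
have N0 : (0 < Num.bound ((x - y) * e)^-1)%N.
  by rewrite -(@ltr0n R); exact: lt_trans bd.
have := xy _ N0; set N := Num.bound _ in bd N0 *.
rewrite lerBlDr -lerBlDl leNgt => /negP; apply.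
rewrite invf_plt ?posrE//; last by rewrite mulr_gt0 ?ltr0n.
move: bd; rewrite invfM ltr_pdivrMr//.
Qed.

Lemma powR_div (R : realType) (x y w : R) :
  0 <= x -> 0 < y -> (x / y) `^ w = x `^ w / y `^ w.
Proof.
move=> x0 y0; have yw0 : y `^ w != 0 by rewrite gt_eqF ?powR_gt0.
apply: (mulIf yw0); rewrite divfK// -powRM ?divr_ge0 ?(ltW y0)//.
by rewrite divfK ?gt_eqF.
Qed.

Lemma sum_pos_argmax (R : realType) (a : nat -> R) (m : nat) :
  (forall i, 0 <= a i) -> 0 < \sum_(i < m) a i ->
  exists i0, [/\ (i0 < m)%N, 0 < a i0 & forall i, (i < m)%N -> a i <= a i0].
Proof.
move=> a0 s0.
have [|||i0 i0m i0P] := @seq_extremum _ (fun i j => a j <= a i) (iota 0 m).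
- by move=> i j; exact: le_total.
- by move=> i j k ji ik; exact: le_trans ik ji.
- by case: m s0 => //; rewrite big_ord0 ltxx.
have {i0P}i0P i : (i < m)%N -> a i <= a i0.
  by move=> im; apply: i0P; rewrite mem_iota.
exists i0; split=> //; first by move: i0m; rewrite mem_iota.
rewrite lt_def a0 andbT; apply/eqP => ai0; move: s0.
rewrite big1 ?ltxx// => i _; apply/eqP.
by rewrite eq_le a0 -ai0 i0P.
Qed.

(** Follows from the approximate form by homogeneity: [a] and [b] are divided by their maxima and
    [S] by the matching product, which leaves [e = y / x]. *)
Lemma two_point_prekopa_leindler (R : realType) (u v x y : R)
    (a b S : nat -> R) (m n : nat) :
  0 < u -> 0 < v -> u + v = 1 -> 0 < y <= x ->
  (forall i, 0 <= a i) -> (forall j, 0 <= b j) -> (forall k, 0 <= S k) ->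
  (forall i j, x * (a i `^ u * b j `^ v) <= S (i + j)%N) ->
  (forall i j, y * (a i `^ u * b j `^ v) <= S (i + j).+1) ->
  (u^-1 `^ u * v^-1 `^ v) / 2 * (x + y) *
    ((\sum_(i < m) a i) `^ u * (\sum_(j < n) b j) `^ v)
  <= \sum_(k < m + n) S k.
Proof.
move=> u0 v0 uv /andP[y0 yx] a0 b0 SP Sx Sy.
have x0 : 0 < x by exact: lt_le_trans yx.
have W0 : 0 <= \sum_(k < m + n) S k by exact: sumr_ge0.
have [A0|A0] := eqVneq (\sum_(i < m) a i) 0.
  by rewrite A0 powR0 ?gt_eqF// mul0r mulr0.
have [B0|B0] := eqVneq (\sum_(i < n) b i) 0.
  by rewrite B0 powR0 ?gt_eqF// !mulr0.
have [||i0 [i0m ai0 aM]] := @sum_pos_argmax R a m => //.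
  by rewrite lt_def A0 sumr_ge0.
have [||j0 [j0n bj0 bM]] := @sum_pos_argmax R b n => //.
  by rewrite lt_def B0 sumr_ge0.
(* Maximality of [a i0] and [b j0] is known only below [m] and [n]; the cut-off keeps the sequences
   at most 1 everywhere. *)
pose a' i := (if (i < m)%N then a i else 0) / a i0.
pose b' j := (if (j < n)%N then b j else 0) / b j0.
pose D := x * (a i0 `^ u * b j0 `^ v).
have D0 : 0 < D by rewrite !mulr_gt0 ?powR_gt0.
pose S' k := S k / D.
have a'P i : 0 <= a' i <= 1.
  rewrite /a' ler_pdivrMr// mul1r; case: ltnP => [/aM|_].
    by rewrite divr_ge0 ?(ltW ai0).
  by rewrite mul0r lexx ltW.
have b'P i : 0 <= b' i <= 1.
  rewrite /b' ler_pdivrMr// mul1r; case: ltnP => [/bM|_].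
    by rewrite divr_ge0 ?(ltW bj0).
  by rewrite mul0r lexx ltW.
have ab' i j : a' i `^ u * b' j `^ v <=
    (a i `^ u * b j `^ v) / (a i0 `^ u * b j0 `^ v).
  have -> : (a i `^ u * b j `^ v) / (a i0 `^ u * b j0 `^ v) =
    (a i / a i0) `^ u * (b j / b j0) `^ v.
    by rewrite !powR_div// invfM mulrACA.
  have a'a : a' i <= a i / a i0.
    by rewrite /a' ler_pM2r ?invr_gt0//; case: ifP.
  have b'b : b' j <= b j / b j0.
    by rewrite /b' ler_pM2r ?invr_gt0//; case: ifP.
  have /andP[? _] := a'P i; have /andP[? _] := b'P j.
  by apply: ler_pM; rewrite ?powR_ge0//; apply: powR_ler.
have e01 : 0 < y / x <= 1 by rewrite divr_gt0//= ler_pdivrMr// mul1r.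
have S'P i j z k : 0 < z -> z * (a i `^ u * b j `^ v) <= S k ->
    z / x * (a' i `^ u * b' j `^ v) <= S' k.
  move=> z0 zS; rewrite /S' ler_pdivlMr//; apply: le_trans zS.
  rewrite [leLHS](_ : _ = z * ((a i0 `^ u * b j0 `^ v) *
      (a' i `^ u * b' j `^ v))); last by rewrite /D; field; rewrite gt_eqF.
  rewrite ler_pM2l// mulrC -ler_pdivlMr ?mulr_gt0 ?powR_gt0//.
have sumD (F : nat -> R) (z : R) k :
    \sum_(i < k) (if (i < k)%N then F i else 0) / z = (\sum_(i < k) F i) / z.
  by rewrite mulr_suml; apply: eq_bigr => i _; rewrite ltn_ord.
have key : (u^-1 `^ u * v^-1 `^ v) / 2 * (1 + y / x) *
    ((\sum_(i < m) a' i) `^ u * (\sum_(j < n) b' j) `^ v)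
  <= \sum_(k < m + n) S' k.
  apply: (@le_of_le_inv_natmul _ (y / x)); first by rewrite divr_gt0.
  move=> N N0.
  apply: (@two_point_prekopa_leindler_approx _ _ _ _ _ _ _ _ _ i0 j0) => //.
  - by move=> k; rewrite divr_ge0// ltW.
  - move=> i j; have := S'P _ _ _ _ x0 (Sx i j).
    by rewrite divff ?mul1r ?gt_eqF.
  - by move=> i j; exact: S'P y0 (Sy i j).
  - by rewrite /a' i0m divff ?gt_eqF.
  - by rewrite /b' j0n divff ?gt_eqF.
move: key; rewrite /a' /b' /S' !sumD -mulr_suml !powR_div ?sumr_ge0//.
rewrite ler_pdivlMr//; apply: le_trans.
set A := (\sum_(i < m) a i) `^ u; set B := (\sum_(j < n) b j) `^ v.
set k2 := u^-1 `^ u * v^-1 `^ v.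
rewrite [leRHS](_ : _ = k2 / 2 * (x + y) * (A * B))// /D; field.
by rewrite !gt_eqF ?powR_gt0.
Qed.

(** * Sumsets and cosets *)

Lemma sumsetP (G : zmodType) (A B : {fset G}) (c : G) :
  reflect (exists a b, [/\ a \in A, b \in B & c = a + b]) (c \in sumset A B).
Proof.
apply: (iffP (imfset2P _ _ _ _ _)) => [[a aA [b bB ->]]|[a [b [aA bB ->]]]].
  by exists a, b.
by exists a => //; exists b.
Qed.

Lemma mem_sumset (G : zmodType) (A B : {fset G}) (a b : G) :
  a \in A -> b \in B -> a + b \in sumset A B.
Proof. by move=> aA bB; apply/sumsetP; exists a, b. Qed.

Lemma sumsetC (G : zmodType) (A B : {fset G}) : sumset A B = sumset B A.
Proof.
apply/fsetP => c; apply/sumsetP/sumsetP => -[a [b [aA bB ->]]];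
by exists b, a; rewrite addrC.
Qed.

Lemma sumsetS (G : zmodType) (A A' B B' : {fset G}) :
  A `<=` A' -> B `<=` B' -> sumset A B `<=` sumset A' B'.
Proof.
move=> /fsubsetP AA' /fsubsetP BB'; apply/fsubsetP => c.
by move=> /sumsetP[a [b [/AA' aA /BB' bB ->]]]; exact: mem_sumset.
Qed.

Lemma card_sumset_ge (G : zmodType) (A B : {fset G}) :
  B != fset0 -> (#|` A| <= #|` sumset A B|)%N.
Proof.
move=> /fset0Pn[b bB].
have <- : #|` [fset a + b | a in A]| = #|` A|.
  by rewrite card_imfset//; exact: addIr.
apply/fsubset_leq_card/fsubsetP => c /imfsetP[a aA ->].
exact: mem_sumset.
Qed.

Lemma sum_card_disjoint_le (T : choiceType) (I : eqType) (W : {fset T})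
    (r : seq I) (F : I -> {fset T}) :
  uniq r -> (forall i, F i `<=` W) ->
  (forall i j z, z \in F i -> z \in F j -> i = j) ->
  (\sum_(i <- r) #|` F i| <= #|` W|)%N.
Proof.
move=> ur FW Fd.
(* Inclusion is asked only along [r], so that in the induction [W] can lose the points of [F i]. *)
suff : forall W : {fset T}, {in r, forall i, F i `<=` W} ->
    (\sum_(i <- r) #|` F i| <= #|` W|)%N by apply=> i _.
elim: r ur {W FW} => [|i r IH] /=; first by rewrite big_nil.
move=> /andP[ir ur] W FW; rewrite big_cons -(cardfsID (F i) W).
apply: leq_add.
  by rewrite fsubset_leq_card// fsubsetI FW ?mem_head ?fsubset_refl.
apply: IH => // j jr; apply/fsubsetP => z zj; rewrite inE.
rewrite (fsubsetP (FW j _)) ?in_cons ?jr ?orbT// andbT.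
by apply/negP => zi; move: ir; rewrite (Fd _ _ _ zi zj) jr.
Qed.

Lemma card_cover_le (T : choiceType) (I : eqType) (W : {fset T})
    (r : seq I) (F : I -> {fset T}) :
  {in W, forall z, exists2 i, i \in r & z \in F i} ->
  (#|` W| <= \sum_(i <- r) #|` F i|)%N.
Proof.
elim: r W => [|i r IH] W WF.
  rewrite big_nil leqn0 cardfs_eq0; apply/negP => /negP/fset0Pn[z /WF[]].
  by [].
rewrite big_cons -(cardfsID (F i) W) leq_add ?fsubset_leq_card ?fsubsetIr//.
apply: IH => z; rewrite inE => /andP[zi /WF[j]].
by rewrite in_cons => /orP[/eqP ->|jr zj]; [rewrite (negPf zi)|exists j].
Qed.

(** * Cosets of a subgroup and the reduction to single cosets *)

Section Subgroup.
Variables (G : zmodType) (K : G -> Prop).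
Hypothesis K_subgroup : is_subgroup K.

Lemma subgroupD a b : K a -> K b -> K (a + b).
Proof. by case: K_subgroup => _ + _; apply. Qed.

Lemma subgroupN a : K a -> K (- a).
Proof. by case: K_subgroup => _ _; apply. Qed.

Lemma subgroupB a b : K a -> K b -> K (a - b).
Proof. by move=> Ka /subgroupN; exact: subgroupD. Qed.

(** A chosen representative turns lying in one coset into a boolean equality in [G]. The default
    branch is never reached, as [g] lies in its own coset. *)
Definition coset_rep (g : G) : G := xget 0 [set h | K (h - g)]%classic.

Lemma coset_repP g : K (coset_rep g - g).
Proof.
have := @xgetI G 0 [set h | K (h - g)]%classic g; apply.
by rewrite /= subrr; case: K_subgroup.
Qed.

Lemma eq_coset_rep g h : coset_rep g = coset_rep h <-> K (g - h).
Proof.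
split=> [E|Kgh].
  have := subgroupB (coset_repP h) (coset_repP g).
  by rewrite E opprB addrC subrKA.
rewrite /coset_rep; congr (xget _ _); apply/seteqP; split => k /= Kk.
  by have := subgroupD Kk Kgh; rewrite addrA subrK.
by have := subgroupB Kk Kgh; rewrite opprB addrA subrK.
Qed.

Definition in_coset (A : {fset G}) : Prop :=
  forall a b, a \in A -> b \in A -> K (a - b).

Definition coset_part (A : {fset G}) (g : G) : {fset G} :=
  [fset a in A | coset_rep a == g].

Lemma in_coset_part A g : in_coset (coset_part A g).
Proof.
move=> a b; rewrite !inE => /andP[_ /eqP ag] /andP[_ /eqP bg].
by apply/eq_coset_rep; rewrite ag.
Qed.

Lemma coset_part_sub A g : coset_part A g `<=` A.
Proof. by apply/fsubsetP => a; rewrite !inE => /andP[]. Qed.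

Lemma max_coset_part A : A != fset0 ->
  exists g, coset_part A g != fset0 /\
    forall h, (#|` coset_part A h| <= #|` coset_part A g|)%N.
Proof.
move=> /fset0Pn[a0 a0A].
have [|||g gA gP] := @seq_extremum _
  (fun g h => #|` coset_part A h| <= #|` coset_part A g|)%N (map coset_rep A).
- by move=> g h; exact: leq_total.
- by move=> g h k hg gk; exact: leq_trans gk hg.
- by apply/eqP => E; have := map_f coset_rep a0A; rewrite E.
exists g; split.
  case/mapP: gA => a aA ->; apply/fset0Pn; exists a.
  by rewrite !inE aA eqxx.
move=> h; have [->|/fset0Pn[a]] := eqVneq (coset_part A h) fset0.
  by rewrite cardfs0.
by rewrite !inE => /andP[aA /eqP <-]; apply: gP; exact: map_f.
Qed.

(** As [B] and [V] each lie in one coset, different parts of [A] have disjoint sumsets with them, so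
    the bounds [hA] add up. A part of size $k \le M$ contributes $k^u \ge k/M^v$. *)
Lemma card_sumset_coset_parts_ge (R : realType) (u v C : R) (M : nat)
    (A B V : {fset G}) :
  0 < u -> 0 < v -> u + v = 1 -> 0 <= C -> (0 < M)%N ->
  in_coset B -> in_coset V ->
  (forall g, (#|` coset_part A g| <= M)%N) ->
  (forall A', A' != fset0 -> in_coset A' ->
    C * (#|` A'|%:R `^ u * #|` B|%:R `^ v) <= #|` sumset (sumset A' B) V|%:R) ->
  C * (#|` A|%:R * (#|` B|%:R `^ v / M%:R `^ v))
    <= #|` sumset (sumset A B) V|%:R.
Proof.
move=> u0 v0 uv C0 M0 cB cV AM hA.
pose r := undup (map coset_rep A).
pose F g := sumset (sumset (coset_part A g) B) V.
have FS g : F g `<=` sumset (sumset A B) V.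
  by rewrite !sumsetS ?coset_part_sub ?fsubset_refl.
have Fd g h z : z \in F g -> z \in F h -> g = h.
  move=> /sumsetP[_ [w [/sumsetP[a [b [aA bB ->]]] wV ->]]].
  move=> /sumsetP[_ [w' [/sumsetP[a' [b' [aA' bB' ->]]] wV' E]]].
  move: aA aA'; rewrite !inE => /andP[_ /eqP <-] /andP[_ /eqP <-].
  apply/eq_coset_rep.
  have -> : a - a' = (b' - b) + (w' - w).
    have -> : a = a' + b' + w' - w - b by rewrite -E !addrK.
    rewrite -!addrA [LHS]addrC -!addrA addNr addr0; congr (_ + _).
    by rewrite [RHS]addrC addrA.
  by apply: subgroupD; [exact: cB|exact: cV].
have := sum_card_disjoint_le (undup_uniq (map coset_rep A)) FS Fd.
rewrite -(ler_nat R); apply: le_trans; rewrite natr_sum.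
have cover : (#|` A| <= \sum_(g <- r) #|` coset_part A g|)%N.
  apply: card_cover_le => a aA; exists (coset_rep a).
    by rewrite mem_undup map_f.
  by rewrite !inE aA eqxx.
have Mv : 0 < M%:R `^ v :> R by rewrite powR_gt0 ?ltr0n.
have w0 : 0 <= #|` B|%:R `^ v / M%:R `^ v :> R by rewrite divr_ge0 ?powR_ge0.
apply: (@le_trans _ _ (C * ((\sum_(g <- r) #|` coset_part A g|)%:R *
    (#|` B|%:R `^ v / M%:R `^ v)))).
  by apply: ler_wpM2l => //; apply: ler_wpM2r => //; rewrite ler_nat.
rewrite natr_sum mulr_suml mulr_sumr; apply: ler_sum => g _.
have [->|A0] := eqVneq (coset_part A g) fset0.
  by rewrite cardfs0 mul0r mulr0.
apply: le_trans (hA _ A0 (@in_coset_part A g)); apply: ler_wpM2l => //.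
rewrite mulrCA [leRHS]mulrC; apply: ler_wpM2l; first exact: powR_ge0.
rewrite ler_pdivrMr//; have k0 : 0 <= #|` coset_part A g|%:R :> R by [].
rewrite -{1}(powR_wmean_id uv k0); apply: ler_wpM2l; first exact: powR_ge0.
by apply: powR_ler; rewrite ?ler_nat.
Qed.

(* The two lower bounds obtained by summing over the parts of A against the
   largest part of B, and conversely, have weighted geometric mean free of
   the sizes of these parts. *)
Lemma card_sumset_ge_of_cosets (R : realType) (u v C : R) (V : {fset G}) :
  0 < u -> 0 < v -> u + v = 1 -> 0 <= C -> in_coset V ->
  (forall A B, A != fset0 -> B != fset0 -> in_coset A -> in_coset B ->
    C * (#|` A|%:R `^ u * #|` B|%:R `^ v) <= #|` sumset (sumset A B) V|%:R) ->
  forall A B, A != fset0 -> B != fset0 ->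
    C * (#|` A|%:R `^ u * #|` B|%:R `^ v) <= #|` sumset (sumset A B) V|%:R.
Proof.
move=> u0 v0 uv C0 cV hC A B A0 B0.
have [g [g0 gP]] := max_coset_part A0; have [h [h0 hP]] := max_coset_part B0.
set Ag := coset_part A g in g0 gP; set Bh := coset_part B h in h0 hP.
have cAg : in_coset Ag := @in_coset_part A g.
have cBh : in_coset Bh := @in_coset_part B h.
set W := #|` sumset (sumset A B) V|%:R : R.
have WA : C * (#|` A|%:R * (#|` Bh|%:R `^ v / #|` Ag|%:R `^ v)) <= W.
  apply: (@le_trans _ _ (#|` sumset (sumset A Bh) V|%:R)); last first.
    by rewrite ler_nat fsubset_leq_card ?sumsetS ?coset_part_sub ?fsubset_refl.
  apply: (@card_sumset_coset_parts_ge _ u) => //; first by rewrite cardfs_gt0.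
  by move=> A' A'0 cA'; exact: hC.
(* The same bound with [A] and [B] exchanged, hence with [u] and [v] exchanged. *)
have WB : C * (#|` B|%:R * (#|` Ag|%:R `^ u / #|` Bh|%:R `^ u)) <= W.
  apply: (@le_trans _ _ (#|` sumset (sumset B Ag) V|%:R)); last first.
    rewrite ler_nat fsubset_leq_card// (sumsetC B).
    by rewrite !sumsetS ?coset_part_sub ?fsubset_refl.
  apply: (@card_sumset_coset_parts_ge _ v) => //; rewrite 1?addrC//.
    by rewrite cardfs_gt0.
  move=> B' B'0 cB'; rewrite (sumsetC B') [X in C * X]mulrC; exact: hC.
have W0 : 0 <= W by exact: ler0n.
have [a0 b0] : 0 < #|` Ag|%:R :> R /\ 0 < #|` Bh|%:R :> R.
  by rewrite !ltr0n !cardfs_gt0.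
rewrite -(powR_wmean_id uv W0).
move: WA WB; set a := #|` Ag|%:R : R in a0 *; set b := #|` Bh|%:R : R in b0 *.
set m := #|` A|%:R : R; set n := #|` B|%:R : R => WA WB.
have [m0 n0] : 0 <= m /\ 0 <= n by rewrite !ler0n.
have f1 : 0 <= C * (m * (b `^ v / a `^ v)).
  by rewrite !mulr_ge0 ?invr_ge0 ?powR_ge0.
have f2 : 0 <= C * (n * (a `^ u / b `^ u)).
  by rewrite !mulr_ge0 ?invr_ge0 ?powR_ge0.
have := ler_pM (powR_ge0 _ _) (powR_ge0 _ _) (powR_ler u0 f1 WA)
  (powR_ler v0 f2 WB).
apply: le_trans.
(* In the product of the [u]-th power of one bound and the [v]-th power of the other, $a^{uv}$ and
   $b^{uv}$ each occur once as a factor and once as a divisor. *)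
have expand w (x y z : R) : 0 <= x -> 0 <= y -> 0 < z ->
    (C * (x * (y / z))) `^ w = C `^ w * (x `^ w * (y `^ w / z `^ w)).
  move=> x0 y0 z0; have yz0 : 0 <= y / z by rewrite divr_ge0// ltW.
  by rewrite (powRM _ C0 (mulr_ge0 x0 yz0)) (powRM _ x0 yz0) powR_div.
rewrite !expand ?powR_ge0 ?powR_gt0// -!powRrM [v * u]mulrC.
rewrite -{1}(powR_wmean_id uv C0).
have [Ka Kb] : 0 < a `^ (u * v) /\ 0 < b `^ (u * v) by rewrite !powR_gt0.
set ka := a `^ (u * v) in Ka *; set kb := b `^ (u * v) in Kb *.
rewrite [leRHS](_ : _ = C `^ u * C `^ v * (m `^ u * n `^ v))//.
by field; rewrite !gt_eqF.
Qed.

End Subgroup.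

(** * Quasicubes *)

Definition extend_subgroup (G : zmodType) (H : G -> Prop) (t : G) (g : G) :=
  exists i : int, H (g - t *~ i).

Lemma extend_subgroupP (G : zmodType) (H : G -> Prop) (t : G) :
  is_subgroup H -> is_subgroup (extend_subgroup H t).
Proof.
move=> sH; split.
- by exists 0; rewrite mulr0z subr0; case: sH.
- move=> a b [i Hi] [j Hj]; exists (i + j).
  by rewrite mulrzDr opprD addrACA; exact: subgroupD.
- by move=> a [i Hi]; exists (- i); rewrite mulrNz -opprD; exact: subgroupN.
Qed.

(** The levels along [t] are integers at first; moving the base point back by a large multiple of
    [t] makes them naturals, as the inequality on sequences requires. *)
Lemma coset_index (G : zmodType) (H : G -> Prop) (t : G) (A : {fset G}) :
  A != fset0 -> in_coset (extend_subgroup H t) A ->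
  exists (g : G) (idx : G -> nat) (m : nat),
    {in A, forall a, (idx a < m)%N /\ H (a - g - t *+ idx a)}.
Proof.
move=> /fset0Pn[a0 a0A] cA.
have [F FP] : exists F : G -> int, {in A, forall a, H (a - a0 - t *~ F a)}.
  have /choice[F FP] : forall a, exists i : int, a \in A -> H (a - a0 - t *~ i).
    move=> a; have [aA|aA] := boolP (a \in A); last by exists 0.
    by have [i Hi] := cA _ _ aA a0A; exists i.
  by exists F => a aA; exact: FP.
(* [L] bounds every $|F(a)|$, so $F(a) + L$ lies between 0 and $2L$. *)
pose L := (\sum_(a <- A) absz (F a))%N.
have FL a : a \in A -> (absz (F a) <= L)%N.
  by move=> aA; rewrite /L (big_rem a)//= leq_addr.
exists (a0 - t *+ L), (fun a => absz (F a + L%:Z)), (L + L).+1 => a aA.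
have FaL := FL _ aA; split; first by lia.
have E : t *+ absz (F a + L%:Z) = t *~ F a + t *+ L.
  rewrite -[t *+ L]/(t *~ L%:Z) -mulrzDr pmulrn; congr (_ *~ _); lia.
rewrite E opprB [t *+ L - _]addrC [t *~ _ + _]addrC opprD !addrA addrK.
exact: FP.
Qed.

(** * Combining bounds on two cosets *)

Section TwoCosets.
Variables (G : zmodType) (R : realType) (u v : R).
Hypotheses (u0 : 0 < u) (v0 : 0 < v) (uv : u + v = 1).

(* This says C <= beta_p(V) when u = 1/p and v = 1/q. *)
Definition sumset_bound (C : R) (V : {fset G}) : Prop :=
  forall A B : {fset G}, A != fset0 -> B != fset0 ->
    C * (#|` A|%:R `^ u * #|` B|%:R `^ v) <= #|` sumset (sumset A B) V|%:R.

(** The sumset has at least $|A|$ and at least $|B|$ elements, hence at least their weighted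
    geometric mean. *)
Lemma sumset_bound1 (V : {fset G}) : V != fset0 -> sumset_bound 1 V.
Proof.
move=> V0 A B A0 B0; rewrite mul1r.
rewrite -[leRHS](powR_wmean_id uv)//.
apply: ler_pM; rewrite ?powR_ge0//; apply: powR_ler; rewrite ?ler_nat//.
  by apply: leq_trans (card_sumset_ge _ V0); exact: card_sumset_ge.
apply: leq_trans (card_sumset_ge _ V0).
by rewrite sumsetC; exact: card_sumset_ge.
Qed.

(** Slicing along $t = x - y$ puts [Vy] at shift 0 and [Vx] at shift 1. The two-point inequality
    wants the smaller constant at shift 1, whence [cx <= cy]. *)
Lemma sumset_bound_two_cosets (H : G -> Prop) (x y : G) (Vx Vy V : {fset G})
    (cx cy : R) :
  is_subgroup H -> (forall n, (0 < n)%N -> ~ H ((x - y) *+ n)) ->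
  {in Vx, forall w, H (w - x)} -> {in Vy, forall w, H (w - y)} ->
  Vx `<=` V -> Vy `<=` V -> V `<=` Vx `|` Vy ->
  0 < cx <= cy -> sumset_bound cx Vx -> sumset_bound cy Vy ->
  sumset_bound ((u^-1 `^ u * v^-1 `^ v) / 2 * (cy + cx)) V.
Proof.
move=> sH Hinf HVx HVy VxV VyV VV /andP[cx0 cxy] bx by_.
have cy0 : 0 < cy by exact: lt_le_trans cxy.
set t := x - y in Hinf *.
have sK := extend_subgroupP t sH.
have KV : in_coset (extend_subgroup H t) V.
  have HK w : w \in V -> extend_subgroup H t (w - y).
    move=> /(fsubsetP VV); rewrite inE => /orP[/HVx Hw|/HVy Hw].
      by exists 1; rewrite mulr1z /t opprB addrA subrK.
    by exists 0; rewrite mulr0z subr0.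
  move=> a b /HK Ka /HK Kb; have := subgroupB sK Ka Kb.
  by rewrite opprB addrA subrK.
(* [V] lies in one coset of $H + \mathbb{Z}t$ because $x = y + t$, so [A] and [B] may be taken in
   single cosets too. *)
apply: (card_sumset_ge_of_cosets sK) => //.
  by rewrite !mulr_ge0 ?powR_ge0 ?invr_ge0 ?addr_ge0 ?ltW.
move=> A B A0 B0 cA cB.
have [ga [ia [m iaP]]] := coset_index A0 cA.
have [gb [ib [n ibP]]] := coset_index B0 cB.
pose Ai i := [fset a in A | ia a == i]; pose Bj j := [fset b in B | ib b == j].
set W := sumset (sumset A B) V.
(* The level [k] slice of the sumset; the infinite order of [t] modulo [H] makes these slices
   disjoint. *)
pose S k := [fset c in W | `[<H (c - (ga + gb + y) - t *+ k)>]].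
have Sd k l z : z \in S k -> z \in S l -> k = l.
  wlog kl : k l / (k <= l)%N.
    by move=> th zk zl; have [/th->//|/ltnW/th->] := leqP k l.
  rewrite !inE => /andP[_ /asboolP Hk] /andP[_ /asboolP Hl].
  apply/eqP; rewrite eqn_leq kl/= leqNgt; apply/negP => lt.
  apply: (Hinf (l - k)%N); first by rewrite subn_gt0.
  have := subgroupB sH Hk Hl; congr H.
  by rewrite opprB mulrnBr// [LHS]addrC subrKA addrC.
have sumS (p : nat) : (\sum_(k < p) #|` S k| <= #|` W|)%N.
  rewrite -(big_mkord xpredT (fun k => #|` S k|)) /index_iota.
  apply: sum_card_disjoint_le => //; first exact: iota_uniq.
  by move=> k; apply/fsubsetP => z; rewrite !inE => /andP[].
have cover (I : {fset G}) (ix : G -> nat) p : {in I, forall a, (ix a < p)%N} ->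
    (#|` I| <= \sum_(i < p) #|` [fset a in I | ix a == i]|)%N.
  move=> ixP.
  rewrite -(big_mkord xpredT (fun i => #|` [fset a in I | ix a == i]|)).
  rewrite /index_iota; apply: card_cover_le => a aI.
  by exists (ix a); rewrite ?mem_iota ?subn0 ?add0n ?ixP// !inE aI eqxx.
have slice (c : R) (V' : {fset G}) (d i j : nat) : 0 <= c ->
    sumset_bound c V' -> V' `<=` V ->
    {in V', forall z, H (z - y - t *+ d)} ->
    c * (#|` Ai i|%:R `^ u * #|` Bj j|%:R `^ v) <= #|` S (i + j + d)%N|%:R.
  move=> c0 bV' V'V HV'.
  have [->|Ai0] := eqVneq (Ai i) fset0.
    by rewrite cardfs0 powR0 ?gt_eqF// mul0r mulr0.
  have [->|Bj0] := eqVneq (Bj j) fset0.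
    by rewrite cardfs0 powR0 ?gt_eqF// !mulr0.
  apply: le_trans (bV' _ _ Ai0 Bj0) _; rewrite ler_nat fsubset_leq_card//.
  apply/fsubsetP => _ /sumsetP[_ [z [/sumsetP[a [b [aA bB ->]]] zV ->]]].
  move: aA bB; rewrite !inE => /andP[aA /eqP iaE] /andP[bB /eqP ibE].
  rewrite !mem_sumset ?(fsubsetP V'V)//=; apply/asboolP.
  have [_ Ha] := iaP _ aA; have [_ Hb] := ibP _ bB.
  have := subgroupD sH (subgroupD sH Ha Hb) (HV' _ zV); congr H.
  have addBB (a1 g1 a2 g2 : G) : a1 - g1 + (a2 - g2) = a1 + a2 - (g1 + g2).
    by rewrite addrACA opprD.
  by rewrite iaE ibE !addBB !mulrnDr.
pose a i : R := #|` Ai i|%:R; pose b j : R := #|` Bj j|%:R.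
apply: (@le_trans _ _ (\sum_(k < m + n) #|` S k|%:R)); last first.
  by rewrite -natr_sum ler_nat.
have := @two_point_prekopa_leindler R u v cy cx a b (fun k => #|` S k|%:R) m n
  u0 v0 uv.
rewrite cx0 cxy => /(_ isT); move=> PL.
apply: le_trans (PL _ _ _ _ _) => //.
- apply: ler_wpM2l.
    by rewrite !mulr_ge0 ?powR_ge0 ?invr_ge0 ?addr_ge0 ?ltW.
  apply: ler_pM; rewrite ?powR_ge0//; apply: powR_ler => //.
    by rewrite -natr_sum ler_nat; apply: cover => z /iaP[].
  by rewrite -natr_sum ler_nat; apply: cover => z /ibP[].
- move=> i j; rewrite -[X in S X]addn0; apply: slice by_ VyV _ => //.
    exact: ltW.
  by move=> z zV; rewrite mulr0n subr0; exact: HVy.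
- move=> i j; rewrite -addn1; apply: slice bx VxV _ => //; first exact: ltW.
  by move=> z zV; rewrite mulr1n /t opprB addrA subrK; exact: HVx.
Qed.

End TwoCosets.

(** * Induction on the dimension and the final bound *)

(** AM-GM at [u^-1] and [v^-1], whose weighted sum is 2. The numerator is the exponential of the
    entropy of $(u, v)$. *)
Lemma entropy_constant_le1 (R : realType) (u v : R) :
  0 < u -> 0 < v -> u + v = 1 -> (u^-1 `^ u * v^-1 `^ v) / 2 <= 1.
Proof.
move=> u0 v0 uv; rewrite ler_pdivrMr ?ltr0n// mul1r.
have [ui0 vi0] : 0 <= u^-1 /\ 0 <= v^-1 by rewrite !invr_ge0 !ltW.
have := powR_mean_le u0 v0 uv ui0 vi0.
by rewrite !divff ?gt_eqF.
Qed.

(** The parts of [V] in the two cosets have constants proportional to their sizes, which add up to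
    $|V|$; each combination costs one factor [k]. *)
Lemma quasicube_sumset_bound (R : realType) (u v : R) (G : zmodType) (d : nat)
    (U : {fset G}) :
  0 < u -> 0 < v -> u + v = 1 -> quasicube d U ->
  forall V, V `<=` U ->
  sumset_bound u v (((u^-1 `^ u * v^-1 `^ v) / 2) ^+ d * #|` V|%:R) V.
Proof.
move=> u0 v0 uv; set k := _ / 2.
have k0 : 0 < k by rewrite !mulr_gt0 ?powR_gt0 ?invr_gt0 ?ltr0n.
have k1 : k <= 1 := entropy_constant_le1 u0 v0 uv.
have bound0 (V : {fset G}) C : V = fset0 -> sumset_bound u v (C * #|` V|%:R) V.
  by move=> -> A B _ _; rewrite cardfs0 mulr0 mul0r.
elim=> {d U} [g|d U Ux Uy H x y sH _ Hxy HU UxP UyP _ IHx _ IHy Hinf] V VU.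
  have [/bound0//|V0] := eqVneq V fset0.
  have -> : V = [fset g].
    by apply/eqP; move: VU; rewrite fsubset1 (negPf V0) orbF.
  rewrite cardfs1 expr0 mulr1; apply: sumset_bound1 => //.
  by rewrite -cardfs_gt0 cardfs1.
pose Vx := V `&` Ux; pose Vy := V `&` Uy.
have HVx : {in Vx, forall w, H (w - x)}.
  by move=> w; rewrite inE => /andP[_ /UxP[]].
have HVy : {in Vy, forall w, H (w - y)}.
  by move=> w; rewrite inE => /andP[_ /UyP[]].
have VE : V = Vx `|` Vy.
  apply/fsetP => w; rewrite !inE -andb_orr; have [wV|//] := boolP (w \in V).
  have wU := fsubsetP VU _ wV; apply/esym/orP.
  by case: (HU _ wU) => Hw; [left; apply/UxP|right; apply/UyP].
have VI : Vx `&` Vy = fset0.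
  apply/eqP/negPn/negP => /fset0Pn[w]; rewrite inE => /andP[/HVx wx /HVy wy].
  by apply: Hxy; have := subgroupB sH wy wx; rewrite opprB addrC addrA subrK.
have cV : #|` V|%:R = #|` Vx|%:R + #|` Vy|%:R :> R.
  by rewrite VE -natrD -cardfsUI VI cardfs0 addn0.
have bx := IHx Vx (fsubsetIr _ _); have by_ := IHy Vy (fsubsetIr _ _).
(* If [V] meets only one of the cosets, the bound from dimension [d] is already enough, as
   [k <= 1]. *)
have weaken (V' : {fset G}) : V = V' ->
    sumset_bound u v (k ^+ d * #|` V'|%:R) V' ->
    sumset_bound u v (k ^+ d.+1 * #|` V|%:R) V.
  move=> <- bV A B A0 B0; apply: le_trans (bV A B A0 B0).
  rewrite exprS -(mulrA k) -(mulrA k); apply: ler_piMl => //.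
  by rewrite !mulr_ge0 ?powR_ge0// exprn_ge0// ltW.
have [Vx0|Vx0] := eqVneq Vx fset0.
  by apply: weaken by_; rewrite {1}VE Vx0 fset0U.
have [Vy0|Vy0] := eqVneq Vy fset0.
  by apply: weaken bx; rewrite {1}VE Vy0 fsetU0.
have pos (V' : {fset G}) : V' != fset0 -> 0 < k ^+ d * #|` V'|%:R.
  by move=> V'0; rewrite mulr_gt0 ?exprn_gt0 ?ltr0n ?cardfs_gt0.
(* The smaller part has to sit at shift 1; in the second case [x] and [y] are exchanged, which turns
   [t] into its opposite. *)
have [xy|yx] := leqP #|` Vx| #|` Vy|.
  have := @sumset_bound_two_cosets G R u v u0 v0 uv H x y Vx Vy V _ _ sH Hinf
    HVx HVy (fsubsetIl _ _) (fsubsetIl _ _) _ _ bx by_.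
  rewrite -/k -mulrDr addrC -cV mulrA -exprS; apply; first by rewrite -VE.
  by rewrite pos//= ler_pM2l ?exprn_gt0// ler_nat.
have Hinf' n : (0 < n)%N -> ~ H ((y - x) *+ n).
  move=> n0 Hn; apply: (Hinf n n0); have := subgroupN sH Hn.
  by rewrite -mulNrn opprB.
have := @sumset_bound_two_cosets G R u v u0 v0 uv H y x Vy Vx V _ _ sH Hinf'
  HVy HVx (fsubsetIl _ _) (fsubsetIl _ _) _ _ by_ bx.
rewrite -/k -mulrDr -cV mulrA -exprS; apply; first by rewrite fsetUC -VE.
by rewrite pos//= ler_pM2l ?exprn_gt0// ler_nat ltnW.
Qed.

Unset Implicit Arguments.

Theorem mainTheorem2 (R : realType) (p : R) (G : zmodType) (d : nat)
    (U V : {fset G}) :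
  1 < p -> quasicube d U -> V `<=` U ->
  let q := (1 - p^-1)^-1 in
  let c := (p `^ (p^-1) * q `^ (q^-1)) / 2 in
  c <= 1 /\ c ^+ d * (#|` V|)%:R <= beta_p p V.
Proof.
move=> p1 qU VU q c.
have p0 : 0 < p by exact: lt_trans p1.
have u0 : 0 < p^-1 by rewrite invr_gt0.
have v0 : 0 < 1 - p^-1 by rewrite subr_gt0 invf_lt1.
have uv : p^-1 + (1 - p^-1) = 1 by rewrite addrC subrK.
have cE : c = (p^-1^-1 `^ p^-1 * (1 - p^-1)^-1 `^ (1 - p^-1)) / 2.
  by rewrite /c /q !invrK.
split; first by rewrite cE; exact: entropy_constant_le1.
have bV := quasicube_sumset_bound u0 v0 uv qU VU; rewrite -cE in bV.
apply: lb_le_inf.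
  (* [lb_le_inf] asks for a nonempty set; $A = B = \{0\}$ provides an element. *)
  exists (#|` sumset (sumset [fset 0] [fset 0]) V|%:R /
    (#|` [fset (0 : G)]|%:R `^ p^-1 * #|` [fset (0 : G)]|%:R `^ (1 - p^-1))).
  exists [fset 0], [fset 0]; split=> //; by rewrite -cardfs_gt0 cardfs1.
move=> _ [A [B [A0 B0 ->]]].
rewrite ler_pdivlMr; first exact: bV.
by rewrite mulr_gt0 ?powR_gt0 ?ltr0n ?cardfs_gt0.
Qed.
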